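(* Let $\mathcal{X}^1,\dots,\mathcal{X}^M$ be smooth complete Riemannian manifolds, let $p\ge1$, and let $\pi=e^{-f}\in\mathcal{P}_p(\times_{i=1}^M\mathcal{X}^i)$. Let $\mu_\star=\mu_\star^1\otimes\dots\otimes\mu_\star^M$ satisfy $\mu_\star^i=\mu_\star^i[\mu_\star^{-i}]$ and $\mu^i_\star\in\mathcal{P}_p(\mathcal{X}^i)$ for all $i$. Assume: (i) for all $i=1,\dots,M$, the optimality map $\mu_\star^i[\cdot]:\times_{j\ne i}\mathcal{P}(\mathcal{X}^j)\to\mathcal{P}(\mathcal{X}^i)$ is Fisher-smooth with constants $\{L_{ij}\}_{j\neq i}$ on $\times_{j\ne i}B_{\varepsilon_j}(\mu_\star^j)$; (ii) for all $i=1,\dots,M$, $\mu_\star^i$ satisfies a transportation-information inequality with constant $\lambda_i$. Define $R\in\mathbb{R}^{M\times M}$ by $R_{ij}=L_{ij}/\lambda_i$ for $i\ne j$ and $R_{ii}=0$, and write $R=R_L+R_U$ with $R_L$ and $R_U$ the (strictly) lower and upper triangular parts of $R$. Suppose $\rho(R)<1$, let $\delta\in(0,\infty)^M$ satisfy $R\delta\prec\delta$, and let $c>0$ be such that $c\,\delta_i\le\varepsilon_i$ for all $i$. If $\mu_k^i\in B_{c\delta_i}(\mu_\star^i)$ for all $i=1,\dots,M$, then the sequential CAVI algorithm $\mu_{k+1}^i=\mu_\star^i[\mu_{k+1}^{<i},\mu_k^{>i}]$, $i=1,\dots,M$ (computed in the order $i=1,2,\dots,M$), satisfies $$W_{k+1,p}\preceq(I_M-R_L)^{-1}R_U\,W_{k,p}.$$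 In particular, $\mu_{k+1}^i\in B_{c\delta_i}(\mu_\star^i)$ for all $i=1,\dots,M$, and the sequential CAVI algorithm converges exponentially fast to $\mu_\star$ in Wasserstein-$p$ distance with rate $\rho\left((I_M-R_L)^{-1}R_U\right)$.
   Context: For a smooth complete Riemannian manifold $\mathcal{X}$ with geodesic distance $\mathsf{d}$ and volume measure $dx$, $\mathcal{P}(\mathcal{X})$ is the set of probability measures and $\mathcal{P}_p(\mathcal{X})$ the set of those absolutely continuous with respect to $dx$ with finite $p$-th moment. Measures are identified with their densities. $\mathbb{W}_p(\varrho_1,\varrho_2)=\inf_{\gamma}(\int \mathsf{d}(x_1,x_2)^p\,d\gamma)^{1/p}$ over couplings $\gamma$; $B_\varepsilon(\varrho)=\{\mu\in\mathcal{P}_p(\mathcal{X}):\mathbb{W}_p(\mu,\varrho)<\varepsilon\}$, $\varepsilon\in(0,\infty]$. Relative Fisher information: $\mathcal{I}(\varrho_1\|\varrho_2)=\int|\nabla\log\frac{d\varrho_1}{d\varrho_2}|^2\,d\varrho_1$ if $\varrho_1\ll\varrho_2$, and $+\infty$ otherwise. Optimality maps: for $\mu^{-i}=(\mu^j)_{j\ne i}$, $\mu_\star^i[\mu^{-i}](x_i)\propto\exp\left(-\mathbb{E}_{\bigotimes_{j\ne i}\mu^j}[f(X^{<i},x_i,X^{>i})]\right)$, where $X^{<i}=(X^1,\dots,X^{i-1})$ and $X^{>i}=(X^{i+1},\dots,X^M)$ (similarly $\mu^{<i}$, $\mu^{>i}$); it is the minimiser of $\mathrm{KL}(\cdot\,\|\pi)$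 over the $i$-th factor with the others fixed. The maps are assumed to be well defined at the measures to which they are applied. Fisher-smoothness: $\mu_\star^i[\cdot]$ is Fisher-smooth with constants $\{L_{ij}\}_{j\ne i}$, $L_{ij}\ge0$, on $\times_{j\ne i}B_{\varepsilon_j}(\mu_\star^j)$ if $\mathcal{I}(\mu_\star^i[\mu^{-i}]\|\mu_\star^i[\mu_\star^{-i}])\le\left(\sum_{j\ne i}L_{ij}\mathbb{W}_p(\mu^j,\mu_\star^j)\right)^2$ for all $\mu^j\in B_{\varepsilon_j}(\mu_\star^j)$, $j\neq i$. Transportation-information inequality: $\gamma\in\mathcal{P}_p(\mathcal{X})$ satisfies it with constant $\lambda>0$ if $\lambda^2\,\mathbb{W}_p^2(\mu,\gamma)\le\mathcal{I}(\mu\|\gamma)$ for all $\mu\in\mathcal{P}(\mathcal{X})$ with $\mu\ll\gamma$. $\rho(\cdot)$ is the spectral radius; $\preceq$ and $\prec$ are entrywise inequalities ($\prec$ strict in every entry). When $\rho(R)<1$, a strictly positive vector $\delta$ with $R\delta\prec\delta$ exists. $W_{k,p}=(\mathbb{W}_p(\mu_k^1,\mu_\star^1),\dots,\mathbb{W}_p(\mu_k^M,\mu_\star^M))^\top$. ''Converges exponentially fast with rate $\rho(A)$'' means that $W_{k+m,p}\preceq A^mW_{k,p}$ for all $m\ge0$, so that $\limsup_{m\to\infty}\|W_{k+m,p}\|^{1/m}\le\rho(A)<1$ (here $A=(I_M-R_L)^{-1}R_U$). *)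

(* Defs.v *)
From HB Require Import structures.
From mathcomp Require Import all_boot all_order all_algebra.
From mathcomp Require Import all_classical all_reals all_analysis.
From mathcomp Require Import complex.
Set Implicit Arguments.
Unset Strict Implicit.
Unset Printing Implicit Defensive.
Import Order.TTheory GRing.Theory Num.Theory.
Import numFieldNormedType.Exports.
Local Open Scope classical_set_scope.
Local Open Scope ring_scope.

Section product_space.
Context (R : realType) (n : nat) (d : 'I_n -> measure_display).
Variable T : forall i, measurableType (d i).

Definition cylinders : set (set (forall i, T i)) :=
  [set C | exists i, exists2 A : set (T i), measurable A &
     C = [set x | A (x i)]].

Definition prod_space := g_sigma_algebraType cylinders.

Definition insert_coord i (z : prod_space * T i) : prod_space :=
  eqtype.dfwith z.1 z.2.

Lemma measurable_insert_coord i : measurable_fun setT (@insert_coord i).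
Proof.
apply: (@measurability _ _ _ _ setT (@insert_coord i) cylinders) => //.
move=> _ [_ [j [A mA ->]]] <-; rewrite setTI.
have [ij|ij] := eqVneq i j.
  subst j.
  have -> : (@insert_coord i) @^-1` [set x | A (x i)] = snd @^-1` A.
    by apply/seteqP; split => z /=; rewrite /insert_coord eqtype.dfwith_in.
  by rewrite -[X in measurable X]setTI; exact: measurable_snd.
have -> : (@insert_coord i) @^-1` [set x | A (x j)] =
    fst @^-1` ([set x | A (x j)] : set prod_space).
  by apply/seteqP; split => z /=; rewrite /insert_coord eqtype.dfwith_out.
rewrite -[X in measurable X]setTI; apply: measurable_fst => //.
by apply: sub_sigma_algebra; exists j, A.
Qed.

Section insert_measure.
Variables (i : 'I_n) (P : {measure set prod_space -> \bar R})
  (m : {sigma_finite_measure set (T i) -> \bar R}).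

(* Resamples the i-th coordinate of P from m, independently. *)
Definition insert_measure : set prod_space -> \bar R :=
  pushforward (P \x m)%E (@insert_coord i).

HB.instance Definition _ := Measure.copy insert_measure
  (measure_function_pushforward__canonical__measure_function_Measure
     (P \x m)%E (@measurable_insert_coord i)).

End insert_measure.

(* The law of x when the coordinates listed in s are replaced by independent
   ones drawn from the m i, the other ones staying frozen at their value in
   x: the product of the m i, i \in s, and of the Dirac masses at x i,
   i \notin s.  Only the m i with i \in s matter. *)
Fixpoint partial_prod (m : forall i, {sigma_finite_measure set (T i) -> \bar R})
    (x : prod_space) (s : seq 'I_n) : {measure set prod_space -> \bar R} :=
  if s is i :: s' then insert_measure (partial_prod m x s') (m i)
  else dirac x.

Definition prod_measure (m : forall i, {sigma_finite_measure set (T i) -> \bar R})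
  : {measure set prod_space -> \bar R} := partial_prod m point (enum 'I_n).

End product_space.

Section calculus.
Context (R : realType).

Fixpoint Ck (V W : normedModType R) (k : nat) (U : set V) (f : V -> W) : Prop :=
  if k is k'.+1 then
    forall v, (forall x, U x -> derivable f x v) /\ Ck k' U (fun x => 'D_v f x)
  else forall x, U x -> {for x, continuous f}.

Definition smooth (V W : normedModType R) (U : set V) (f : V -> W) : Prop :=
  forall k, Ck k U f.

Variable n : nat.

(* R^n as the product of n copies of the Borel line; row_of identifies it with
   the normed space 'rV[R]_n. *)
Definition coord_space := prod_space (fun _ : 'I_n => measurableTypeR R).

Definition row_of (t : coord_space) : 'rV[R]_n := \row_j t j.

Definition lebesgue_n : {measure set coord_space -> \bar R} :=
  @prod_measure R n _ (fun _ => measurableTypeR R) (fun _ => lebesgue_measure).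

Definition test_function (U : set 'rV[R]_n) (psi : 'rV[R]_n -> R) : Prop :=
  smooth setT psi /\
  exists K, [/\ compact K, K `<=` U & forall y, ~ K y -> psi y = 0].

Definition locally_integrable (U : set 'rV[R]_n) (u : 'rV[R]_n -> R) : Prop :=
  forall K, compact K -> K `<=` U ->
    lebesgue_n.-integrable (row_of @^-1` K) (fun t => (u (row_of t))%:E).

Definition weak_gradient (U : set 'rV[R]_n) (u : 'rV[R]_n -> R)
    (v : 'rV[R]_n -> 'rV[R]_n) : Prop :=
  locally_integrable U u /\
  forall j, locally_integrable U (fun y => v y 0 j) /\
    forall psi, test_function U psi ->
      (\int[lebesgue_n]_(t in row_of @^-1` U)
         (u (row_of t) * 'D_(delta_mx 0 j) psi (row_of t))%:E =
       - \int[lebesgue_n]_(t in row_of @^-1` U)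
         (v (row_of t) 0 j * psi (row_of t))%:E)%E.

End calculus.
Arguments row_of {R n}.

#[short(type="pmetricType")]
HB.structure Definition PMetric (K : numDomainType) :=
  {M of Metric K M & Pointed M}.

Record chart (R : realType) (X : topologicalType) (n : nat) := Chart {
  chart_dom : set X ;
  chart_map : X -> 'rV[R]_n ;
  chart_inv : 'rV[R]_n -> X ;
  chart_dom_open : open chart_dom ;
  chart_im_open : open (chart_map @` chart_dom) ;
  chart_mapK : forall x, chart_dom x -> chart_inv (chart_map x) = x ;
  chart_map_cont : forall x, chart_dom x -> {for x, continuous chart_map} ;
  chart_inv_cont : forall y, (chart_map @` chart_dom) y ->
    {for y, continuous chart_inv}
}.

Definition chart_im (R : realType) (X : topologicalType) n (phi : chart R X n) :
  set 'rV[R]_n := chart_map phi @` chart_dom phi.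

(* The value at (u, v) of the bilinear form with Gram matrix G. *)
Definition gram (R : realType) n (G : 'M[R]_n) (u v : 'rV[R]_n) : R :=
  (u *m G *m v^T) 0 0.

Section atlas.
Context (R : realType) (X : topologicalType) (n : nat).
Variable atlas : set (chart R X n).
(* g phi y is the Gram matrix of the metric at the point of coordinates y in
   the chart phi. *)
Variable g : chart R X n -> 'rV[R]_n -> 'M[R]_n.

Definition smooth_atlas : Prop :=
  (forall x, exists2 phi, atlas phi & chart_dom phi x) /\
  (forall phi psi, atlas phi -> atlas psi ->
     smooth (chart_map phi @` (chart_dom phi `&` chart_dom psi))
       (fun y => chart_map psi (chart_inv phi y))).

Definition riemannian_metric : Prop :=
  (forall phi, atlas phi ->
     (forall i j, smooth (chart_im phi) (fun y => (g phi y i j : R^o))) /\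
     (forall y, chart_im phi y ->
        (g phi y)^T = g phi y /\
        forall u, u != 0 -> 0 < gram (g phi y) u u)) /\
  (forall phi psi, atlas phi -> atlas psi ->
     forall y, (chart_map phi @` (chart_dom phi `&` chart_dom psi)) y ->
     let tau z := chart_map psi (chart_inv phi z) in
     forall u v, gram (g phi y) u v =
                 gram (g psi (tau y)) ('D_u tau y) ('D_v tau y)).

(* Piecewise C^1 curves, cut into pieces each lying in one chart; every piece
   is reparametrised by [0, 1] and its coordinates are extended to a C^1
   function on the whole line. *)
Inductive curve_length : X -> X -> \bar R -> Prop :=
| CurveNil x : curve_length x x 0%E
| CurveCons phi (c : R^o -> 'rV[R]_n) z l :
    atlas phi -> Ck 1 setT c ->
    (forall t : R, 0 <= t <= 1 -> chart_im phi (c t)) ->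
    curve_length (chart_inv phi (c 1)) z l ->
    curve_length (chart_inv phi (c 0)) z
      (\int[lebesgue_measure]_(t in `[0%R, 1%R])
         (Num.sqrt (gram (g phi (c t)) ('D_1 c t) ('D_1 c t)))%:E + l)%E.

Definition riemannian_volume
    (vol : set X -> \bar R) : Prop :=
  forall phi, atlas phi -> forall A : set X, <<s @open X >> A ->
    A `<=` chart_dom phi ->
    vol A = (\int[lebesgue_n R n]_(t in row_of @^-1` (chart_map phi @` A))
               (Num.sqrt (\det (g phi (row_of t))))%:E)%E.

End atlas.

(* Complete (as a metric space, for the geodesic distance), connected, smooth
   Riemannian manifolds.  The carrier is a metric space whose distance is
   required to be the geodesic distance; since distances are finite, the
   manifold is connected.  Likewise rm_vol is the volume measure. *)
Record riemannian (R : realType) := Riemannian {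
  rm_space : pmetricType R ;
  rm_dim : nat ;
  rm_atlas : set (chart R rm_space rm_dim) ;
  rm_metric : chart R rm_space rm_dim -> 'rV[R]_rm_dim -> 'M[R]_rm_dim ;
  rm_vol : {sigma_finite_measure set (g_sigma_algebraType (@open rm_space))
             -> \bar R} ;
  rm_second_countable : @second_countable rm_space ;
  rm_smooth : smooth_atlas rm_atlas ;
  rm_metricP : riemannian_metric rm_atlas rm_metric ;
  rm_geodesic : forall x y : rm_space,
    (mdist x y)%:E = ereal_inf [set l | curve_length rm_atlas rm_metric x y l] ;
  rm_complete : forall u : nat -> rm_space, cauchy (u @ \oo) -> cvg (u @ \oo) ;
  rm_volP : riemannian_volume rm_atlas rm_metric rm_vol
}.

Notation pts X := (g_sigma_algebraType (@open (rm_space X))).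

Definition gdist (R : realType) (X : riemannian R) (x y : pts X) : R :=
  @mdist R (rm_space X) x y.

Section measures.
Context (R : realType) (X : riemannian R).
Local Open Scope ereal_scope.
Implicit Types mu nu rho : probability (pts X) R.

Definition Pp (p : R) mu : Prop :=
  mu `<< rm_vol X /\
  exists x0 : pts X, \int[mu]_x (gdist x0 x `^ p)%:E < +oo.

Definition coupling mu nu (gamma : probability (pts X * pts X)%type R) : Prop :=
  forall A : set (pts X), measurable A ->
    gamma (A `*` setT) = mu A /\ gamma (setT `*` A) = nu A.

Definition wasserstein (p : R) mu nu : \bar R :=
  ereal_inf [set (\int[gamma]_z (gdist z.1 z.2 `^ p)%:E) `^ (p^-1)%R
            | gamma in coupling mu nu].

Definition wball (p : R) (eps : \bar R) rho : set (probability (pts X) R) :=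
  [set mu | Pp p mu /\ wasserstein p mu rho < eps].

(* q is the squared Riemannian norm of the weak gradient of h: in coordinates,
   |grad h|^2 = g^{kl} d_k h d_l h. *)
Definition sqnorm_gradient (h q : pts X -> R) : Prop :=
  forall phi, rm_atlas phi ->
    exists2 v : 'rV[R]_(rm_dim X) -> 'rV[R]_(rm_dim X),
      weak_gradient (chart_im phi) (fun y => h (chart_inv phi y)) v &
      {ae rm_vol X, forall x, chart_dom phi x ->
         q x = let y := chart_map phi x in
               gram (invmx (rm_metric phi y)) (v y) (v y)}.

Definition density_of nu1 nu2 (h : pts X -> R) : Prop :=
  [/\ measurable_fun setT h, (forall x, 0 <= h x)%R &
      forall A, measurable A -> nu1 A = \int[nu2]_(x in A) (h x)%:E].

(* |grad log h|^2 = |grad h|^2 / h^2, for a version h of the density that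
   belongs to W^{1,1}_loc; the infimum ranges over such versions, on which the
   integral does not depend, and is +oo when there are none.  For
   nu1 << nu2 << rm_vol X the null sets of rm_vol X are irrelevant. *)
Definition fisher nu1 nu2 : \bar R :=
  if `[< nu1 `<< nu2 >] then
    ereal_inf [set e | exists h q : pts X -> R,
      [/\ density_of nu1 nu2 h, measurable_fun setT q, sqnorm_gradient h q &
          e = \int[nu1]_x (q x / h x ^+ 2)%:E]]
  else +oo.

Definition transport_information (p : R) (gamma : probability (pts X) R)
    (lambda : R) : Prop :=
  [/\ Pp p gamma, (0 < lambda)%R &
   forall mu, mu `<< gamma ->
     (lambda ^+ 2)%:E * wasserstein p mu gamma ^+ 2 <= fisher mu gamma].

End measures.

Section cavi.
Context (R : realType) (M : nat) (X : 'I_M -> riemannian R).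
Local Open Scope ereal_scope.

Notation prodX := (prod_space (fun i => pts (X i))).
Notation family := (forall i, probability (pts (X i)) R).

Definition volume_prod : {measure set prodX -> \bar R} :=
  prod_measure (fun i => rm_vol (X i)).

Definition gdist_prod (x y : prodX) : R :=
  Num.sqrt (\sum_i gdist (x i) (y i) ^+ 2)%R.

(* pi = e^{-f} is a probability density with finite p-th moment *)
Definition gibbs_Pp (p : R) (f : prodX -> R) : Prop :=
  [/\ measurable_fun setT f,
      \int[volume_prod]_x (expR (- f x))%:E = 1 &
      exists x0, \int[volume_prod]_x (gdist_prod x0 x `^ p * expR (- f x))%:E
        < +oo].

Variable f : prodX -> R.

(* The law of (X^{<i}, xi, X^{>i}) with X^j ~ mu j independent, j != i; the
   component mu i is not used. *)
Definition others_law (mu : family) i (xi : pts (X i)) :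
    {measure set prodX -> \bar R} :=
  partial_prod (fun j => mu j) (eqtype.dfwith (point : prodX) xi)
    [seq j <- enum 'I_M | j != i].

Definition mean_f (mu : family) i (xi : pts (X i)) : \bar R :=
  \int[others_law mu xi]_x (f x)%:E.

Definition opt_mass (mu : family) i : \bar R :=
  \int[rm_vol (X i)]_xi expeR (- mean_f mu xi).

Definition opt_welldef (i : 'I_M) (mu : family) : Prop :=
  {ae rm_vol (X i), forall xi,
     \int[others_law mu xi]_x (Num.max (f x) 0)%:E < +oo \/
     \int[others_law mu xi]_x (Num.max (- f x) 0)%:E < +oo} /\
  0 < opt_mass mu i < +oo.

(* The probability measure with density proportional to exp(- mean_f); the
   default value dirac is only taken where the map is not well defined. *)
Definition opt_map (i : 'I_M) (mu : family) : probability (pts (X i)) R :=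
  xget (dirac (point : pts (X i)) : probability (pts (X i)) R)
    [set nu | forall A, measurable A ->
       nu A = ((fine (opt_mass mu i))^-1)%:E *
              \int[rm_vol (X i)]_(xi in A) expeR (- mean_f mu xi)].

Definition fisher_smooth (p : R) (eps : 'I_M -> \bar R) (mustar : family)
    (i : 'I_M) (L : 'I_M -> R) : Prop :=
  (forall j, j != i -> (0 <= L j)%R) /\
  forall mu : family, (forall j, j != i -> wball p (eps j) (mustar j) (mu j)) ->
    fisher (opt_map i mu) (opt_map i mustar) <=
      (\sum_(j | j != i) (L j)%:E * wasserstein p (mu j) (mustar j)) ^+ 2.

(* Measures are total functions on sets and only their values on measurable
   sets matter. *)
Definition same_measure d (T : measurableType d) (mu nu : set T -> \bar R) :=
  forall A, measurable A -> mu A = nu A.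

End cavi.

Definition spectral_radius (R : realType) n (A : 'M[R]_n) : R :=
  sup [set ComplexField.Normc.normc z
      | z in [set z : R[i] | eigenvalue (map_mx (real_complex R) A) z]].

Definition low_part (R : realType) n (A : 'M[R]_n) : 'M[R]_n :=
  \matrix_(i, j) if (j < i)%N then A i j else 0.

Definition up_part (R : realType) n (A : 'M[R]_n) : 'M[R]_n :=
  \matrix_(i, j) if (i < j)%N then A i j else 0.

Definition mxle (R : realType) m n (A B : 'M[R]_(m, n)) : Prop :=
  forall i j, A i j <= B i j.

Definition mxlt (R : realType) m n (A B : 'M[R]_(m, n)) : Prop :=
  forall i j, A i j < B i j.

Definition wasserstein_vec (R : realType) (M : nat) (X : 'I_M -> riemannian R)
    (p : R) (mu nu : forall i, probability (pts (X i)) R) : 'cV[R]_M :=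
  \col_i fine (wasserstein p (mu i) (nu i)).

(* The iterates stay at finite distance from nu, so that the entries of
   wasserstein_vec are the distances themselves. *)
Definition converges_exponentially (R : realType) (M : nat)
    (X : 'I_M -> riemannian R) (p : R)
    (mu : nat -> forall i, probability (pts (X i)) R)
    (nu : forall i, probability (pts (X i)) R) (k : nat) (A : 'M[R]_M) : Prop :=
  let W m := wasserstein_vec p (mu m) nu in
  [/\ forall m i, (wasserstein p (mu (k + m)%N i) (nu i) < +oo)%E,
      forall m, mxle (W (k + m)%N) (A ^+ m *m W k),
      (limn_esup (fun m => (`|W (k + m)%N| `^ m%:R^-1)%:E)
         <= (spectral_radius A)%:E)%E &
      spectral_radius A < 1].

(* Main.v *)
(* Fisher-smoothness of the i-th optimality map followed by the
   transportation-information inequality for the i-th factor gives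
     W_{k+1,i} <= sum_{j<i} R_ij W_{k+1,j} + sum_{j>i} R_ij W_{k,j},
   and R delta < delta keeps each new factor in its ball during the sweep.
   Hence (1 - R_L) W_{k+1} <= R_U W_k, and 1 - R_L has a nonnegative inverse, so
   W_{k+1} <= A W_k with A = (1 - R_L)^{-1} R_U.  Since
   (1 - R_L)(delta - A delta) = delta - R delta > 0, also A delta < delta, and
   testing left eigenvectors of A against delta gives rho(A) < 1.  For r > rho(A)
   the entries of A^m are O(r^m): by Cayley-Hamilton they satisfy a linear
   recurrence whose characteristic roots are eigenvalues of A. *)
Require Import Defs.
From HB Require Import structures.
From mathcomp Require Import all_boot all_order all_algebra.
From mathcomp Require Import all_classical all_reals all_analysis.
From mathcomp Require Import measurable_realfun complex.
From mathcomp Require Import ring lra.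
Set Implicit Arguments.
Unset Strict Implicit.
Unset Printing Implicit Defensive.
Import Order.TTheory GRing.Theory Num.Theory.
Import numFieldNormedType.Exports.
Local Open Scope classical_set_scope.
Local Open Scope ring_scope.

(** * Spectral radius and growth of matrix powers *)

(* Peeling off one factor, B A^(m+1) = z B A^m + (B (A - z)) A^m, so a bound
   for B (A - z) sums along a geometric series of ratio |z| < r. *)
Lemma annihilated_powers_bound (C : numFieldType) n (A : 'M[C]_n.+1) (r : C) :
  0 < r -> forall s : seq C, (forall z, z \in s -> `|z| < r) ->
  forall B : 'M[C]_n.+1, B * \prod_(z <- s) (A - z%:M) = 0 ->
  exists2 K : C, 0 <= K & forall m i j, `|(B * A ^+ m) i j| <= K * r ^+ m.
Proof.
move=> r0; elim=> [_ B|z s IH sr B].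
  rewrite big_nil mulr1 => ->; exists 0 => // m i j.
  by rewrite mul0r mxE normr0 mul0r.
rewrite big_cons mulrA => /IH[|K' K'0 HK'].
  by move=> w ws; apply: sr; rewrite inE ws orbT.
have zr : 0 < r - `|z| by rewrite subr_gt0 sr// mem_head.
set S := \sum_i \sum_j `|B i j|.
have S0 : 0 <= S by do 2 (apply: sumr_ge0 => ? _).
(* The constant must satisfy [|z| K + K' <= r K]: the second summand alone gives equality, and [S]
   covers the entries of [B] at [m = 0]. *)
exists (S + K' / (r - `|z|)); first by rewrite addr_ge0// divr_ge0// ltW.
elim=> [|m IHm] i j.
  rewrite expr0 !mulr1 /S (bigD1 i)//= (bigD1 j)//= -!addrA lerDl.
  by rewrite !addr_ge0 ?sumr_ge0 ?divr_ge0 ?(ltW zr)// => k _; apply: sumr_ge0.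
have -> : B * A ^+ m.+1 = z *: (B * A ^+ m) + B * (A - z%:M) * A ^+ m.
  rewrite mulrBr mulrBl exprS mulrA [B * z%:M]mul_mx_scalar -scalerAl.
  by rewrite addrC subrK.
rewrite mxE (le_trans (ler_normD _ _))// mxE normrM.
rewrite (le_trans (lerD (ler_wpM2l _ (IHm i j)) (HK' m i j)))//.
rewrite mulrA -mulrDl exprS mulrA ler_wpM2r ?exprn_ge0 ?(ltW r0)//.
rewrite -subr_ge0.
have -> : (S + K' / (r - `|z|)) * r - (`|z| * (S + K' / (r - `|z|)) + K')
    = S * (r - `|z|) by field; rewrite gt_eqF.
by rewrite mulr_ge0// ltW.
Qed.

Lemma normc_ge0 (R : rcfType) (z : R[i]) : 0 <= ComplexField.Normc.normc z.
Proof. by case: z => a b; exact: sqrtr_ge0. Qed.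

(** Eigenvalues are roots of the characteristic polynomial, so the sum of the moduli of all roots
    bounds the set whose [sup] is taken. *)
Lemma eigenvalue_le_spectral_radius (R : realType) n (A : 'M[R]_n) (z : R[i]) :
  eigenvalue (map_mx (real_complex R) A) z ->
  ComplexField.Normc.normc z <= spectral_radius A.
Proof.
move=> Az; rewrite /spectral_radius; apply: ub_le_sup; last by exists z.
have [s chars] := closed_field_poly_normal (char_poly (map_mx (real_complex R) A)).
exists (\sum_(w <- s) ComplexField.Normc.normc w) => _ [w /= Aw <-].
have ws : w \in s.
  move: Aw; rewrite eigenvalue_root_char chars (monicP (char_poly_monic _)).
  by rewrite scale1r root_prod_XsubC.
rewrite (big_rem w)//= lerDl sumr_ge0// => u _.
exact: normc_ge0.
Qed.

Lemma normc_real_complex (R : rcfType) (z : R[i]) :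
  `|z| = (ComplexField.Normc.normc z)%:C%C.
Proof. by case: z. Qed.

(** Over the complex numbers, Cayley-Hamilton makes the product of the [A - z] over the roots
    vanish, so the peeling bound applies with [B = 1]. *)
Lemma mx_exp_bound (R : realType) n (A : 'M[R]_n) (r : R) :
  spectral_radius A < r -> 0 < r ->
  exists2 K : R, 0 <= K & forall m i j, `|(A ^+ m) i j| <= K * r ^+ m.
Proof.
case: n A => [A _ _|n A Ar r0]; first by exists 0 => // m [].
pose phi := real_complex R; pose AC := map_mx phi A.
have [s chars] := closed_field_poly_normal (char_poly AC).
rewrite (monicP (char_poly_monic _)) scale1r in chars.
have [//| |//|K K0 HK] := @annihilated_powers_bound _ n AC (phi r) _ s _ 1.
- by rewrite ltcR.
- move=> z zs; rewrite normc_real_complex ltcR (le_lt_trans _ Ar)//.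
  apply: eigenvalue_le_spectral_radius.
  by rewrite eigenvalue_root_char chars root_prod_XsubC.
- rewrite mul1r; have := Cayley_Hamilton AC; rewrite chars rmorph_prod => <-.
  apply: eq_bigr => z _.
  by rewrite rmorphB/= horner_mx_X horner_mx_C.
(* A nonnegative complex number is real. *)
have KE : K = phi (complex.Re K) by apply/esym/RRe_real/ger0_real.
exists (complex.Re K) => [|m i j]; first by rewrite -ler0c -[_%:C%C]KE.
have := HK m i j; rewrite mul1r KE.
have -> : AC ^+ m = map_mx phi (A ^+ m) by rewrite rmorphXn.
rewrite mxE -rmorphXn -rmorphM.
by rewrite normc_real_complex /= expr0n/= addr0 sqrtr_sqr lecR.
Qed.

Lemma mxle0_ge0 (R : realType) m n (A : 'M[R]_(m, n)) i j :
  mxle 0 A -> 0 <= A i j.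
Proof. by move=> /(_ i j); rewrite mxE. Qed.

(** If [v A = z v], the triangle inequality gives [|z| |v| <= |v| A] entrywise; pairing with [delta]
    yields [|z| <= theta]. *)
Lemma spectral_radius_lt1 (R : realType) n (A : 'M[R]_n) (delta : 'cV[R]_n) :
  mxle 0 A -> (forall i, 0 < delta i 0) -> mxlt (A *m delta) delta ->
  spectral_radius A < 1.
Proof.
move=> A0 d0 Ad.
(* A maximum over finitely many indices stays below 1; the default 0 covers size 0. *)
pose theta := \big[Order.max/0]_i ((A *m delta) i 0 / delta i 0).
have theta1 : theta < 1.
  by apply/bigmax_ltP; split => // i _; rewrite ltr_pdivrMr// mul1r.
have Atheta i : (A *m delta) i 0 <= theta * delta i 0.
  rewrite -ler_pdivrMr//.
  exact: (le_bigmax _ (fun i => (A *m delta) i 0 / delta i 0)).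
apply: le_lt_trans theta1.
have theta0 : 0 <= theta by exact: bigmax_ge_id.
rewrite /spectral_radius; set S := [set _ | _ in _].
have [->|S0] := eqVneq S set0; first by rewrite sup0.
apply: ge_sup; first exact/set0P.
move=> _ [z /eigenvalueP[v vA v0] <-].
pose N (i : 'I_n) := ComplexField.Normc.normc (v 0 i).
have N0 i : 0 <= N i by exact: normc_ge0.
have Npos : 0 < \sum_i N i * delta i 0.
  have [i vi] : exists i, v 0 i != 0.
    by apply/existsP; rewrite -negb_forall; apply: contra v0 => /forallP vz;
      apply/eqP/rowP => i; rewrite mxE; apply/eqP; exact: vz.
  rewrite (bigD1 i)//= ltr_pwDl//.
    rewrite mulr_gt0// lt_neqAle N0 andbT eq_sym; apply: contra vi => /eqP.
    by move=> /ComplexField.Normc.eq0_normc ->.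
  by apply: sumr_ge0 => j _; rewrite mulr_ge0// ltW.
rewrite -(ler_pM2r Npos) mulr_sumr.
have zN j : ComplexField.Normc.normc z * N j <= \sum_i N i * A i j.
  rewrite -lecR rmorphM/= -!normc_real_complex -normrM.
  have -> : z * v 0 j = (z *: v) 0 j by rewrite mxE.
  rewrite -vA mxE (le_trans (ler_norm_sum _ _ _))// rmorph_sum/=.
  apply: ler_sum => i _; rewrite mxE normrM normc_real_complex rmorphM/=.
  rewrite normc_real_complex /= expr0n/= addr0 sqrtr_sqr ger0_norm//.
  exact: mxle0_ge0 A0.
apply: (@le_trans _ _ (\sum_j (\sum_i N i * A i j) * delta j 0)).
  by apply: ler_sum => j _; rewrite mulrA ler_wpM2r// ltW.
under eq_bigr do rewrite mulr_suml.
rewrite exchange_big/= mulr_sumr; apply: ler_sum => i _.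
rewrite mulrCA; under eq_bigr do rewrite -mulrA.
by rewrite -mulr_sumr ler_wpM2l//; have := Atheta i; rewrite mxE.
Qed.

(** * Inverse positivity of [1 - low_part A] *)

(** Forward substitution: row [i] bounds [x i] below by a combination of the [x j] with [j < i],
    nonnegative by strong induction. *)
Lemma low_part_resolvent_ge0 (R : realType) n (A : 'M[R]_n) (x : 'cV[R]_n) :
  mxle 0 A -> mxle 0 ((1%:M - low_part A) *m x) -> mxle 0 x.
Proof.
move=> A0 Ax i j; rewrite mxE ord1 {j}.
have [m im] := ubnP (val i); elim: m i im => // m IH i im.
have := Ax i 0; rewrite mulmxBl mul1mx !mxE subr_ge0; apply: le_trans.
apply: sumr_ge0 => j _; rewrite mxE; case: ifPn => [ji|_]; last by rewrite mul0r.
rewrite mulr_ge0//; first exact: mxle0_ge0 A0.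
by apply: IH; exact: leq_trans ji im.
Qed.

Lemma low_part_resolvent_gt0 (R : realType) n (A : 'M[R]_n) (x : 'cV[R]_n) :
  mxle 0 A -> mxlt 0 ((1%:M - low_part A) *m x) -> mxlt 0 x.
Proof.
move=> A0 Ax; have x0 : mxle 0 x.
  by apply: (low_part_resolvent_ge0 A0) => i j; rewrite ltW.
move=> i j; have := Ax i j; rewrite mulmxBl mul1mx !mxE subr_gt0.
apply: le_lt_trans; apply: sumr_ge0 => k _; rewrite mulr_ge0//.
  by rewrite mxE; case: ifP => // _; exact: mxle0_ge0 A0.
exact: mxle0_ge0 x0.
Qed.

Lemma unitmx_sub1_low_part (R : realType) n (A : 'M[R]_n) :
  1%:M - low_part A \in unitmx.
Proof.
rewrite unitmxE det_trig.
  rewrite big1 ?unitr1// => i _.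
  by rewrite !mxE eqxx ltnn subr0.
apply/is_trig_mxP => i j ij; rewrite !mxE ltnNge (ltnW ij)/= subr0.
by rewrite (_ : i == j = false)//; apply/negbTE; rewrite -val_eqE/= ltn_eqF.
Qed.

Lemma low_upD (R : realType) n (A : 'M[R]_n) :
  (forall i, A i i = 0) -> low_part A + up_part A = A.
Proof.
move=> Ad; apply/matrixP => i j; rewrite !mxE.
case: ltngtP => [_|_|/ord_inj ->]; rewrite ?addr0 ?add0r//.
Qed.

(** * From geometric bounds to the root rate *)

Lemma spectral_radius_ge0 (R : realType) n (A : 'M[R]_n) :
  0 <= spectral_radius A.
Proof.
have [[z Az]|nz] := pselect (exists z, eigenvalue (map_mx (real_complex R) A) z).
  exact: le_trans (normc_ge0 z) (eigenvalue_le_spectral_radius Az).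
rewrite /spectral_radius; set S := [set _ | _ in _].
have [->|/set0P[_ [z Az _]]] := eqVneq S set0; first by rewrite sup0.
by case: nz; exists z.
Qed.

(** A rate [r] strictly between [rho] and [r' = rho + e] leaves room for the constant:
    [K (r / r')^m] tends to 0, so eventually [u m <= r' ^+ m]. *)
Lemma limn_esup_root_le (R : realType) (u : R^nat) (rho : R) :
  0 <= rho -> (forall m, 0 <= u m) ->
  (forall r, rho < r ->
     exists2 K : R, 0 <= K & forall m, u m <= K * r ^+ m) ->
  (limn_esup (fun m => (u m `^ m%:R^-1)%:E) <= rho%:E)%E.
Proof.
move=> rho0 u0 uK; apply/lee_addgt0Pr => e e0; rewrite -EFinD.
set r' := rho + e; have r'0 : 0 < r' by rewrite /r' ltr_wpDl.
pose r := rho + e / 2; have r0 : 0 < r by rewrite /r ltr_wpDl// divr_gt0.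
have rr' : r < r' by rewrite /r /r'; lra.
have [|K K0 HK] := uK r; first by rewrite /r ltrDl divr_gt0.
have q1 : `|r / r'| < 1.
  by rewrite ger0_norm ?divr_ge0 ?ltW// ltr_pdivrMr// mul1r.
have K1 : 0 < (K + 1)^-1 by rewrite invr_gt0 ltr_wpDl.
rewrite limn_esup_lim; apply: lime_le; first exact: is_cvg_esups.
have /cvgrPdist_lt/(_ _ K1)[N _ HN] := cvg_expr q1.
near=> n; apply: ge_ereal_sup => _ [m /= nm <-]; rewrite lee_fin.
have Nm : (N <= m)%N by apply: leq_trans nm; near: n; exists N.
(* At [m = 0] the exponent [m%:R^-1] is 0 and does not undo the power. *)
have m0 : (0 < m)%N by apply: leq_trans nm; near: n; exists 1%N.
have ur' : u m <= r' ^+ m.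
  apply: le_trans (HK m) _.
  have := HN m Nm; rewrite /= sub0r normrN ger0_norm; last first.
    by rewrite exprn_ge0// divr_ge0// ltW.
  rewrite expr_div_n ltr_pdivrMr ?exprn_gt0// => H.
  apply: le_trans (ler_wpM2l K0 (ltW H)) _.
  rewrite mulrA ler_piMl ?exprn_ge0 ?(ltW r'0)//.
  by rewrite ler_pdivrMr ?mul1r ?lerDl// ltr_wpDl.
apply: (@le_trans _ _ ((r' ^+ m) `^ m%:R^-1)).
  by rewrite ge0_ler_powR ?invr_ge0 ?nnegrE ?exprn_ge0 ?(ltW r'0).
rewrite -powR_mulrn ?(ltW r'0)// -powRrM divff ?powRr1 ?(ltW r'0)//.
by rewrite pnatr_eq0 -lt0n.
Unshelve. all: by end_near. Qed.

(** * Wasserstein distance, Fisher information and moments *)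

Lemma powRD_le (R : realType) (p a b : R) : 0 <= p -> 0 <= a -> 0 <= b ->
  (a + b) `^ p <= 2 `^ p * (a `^ p + b `^ p).
Proof.
move=> p0 a0 b0; wlog ab : a b a0 b0 / a <= b.
  move=> H; have [ab|/ltW ba] := leP a b; first exact: H.
  by rewrite addrC [X in _ * X]addrC H.
apply: (@le_trans _ _ ((2 * b) `^ p)).
  by rewrite ge0_ler_powR ?nnegrE ?addr_ge0 ?mulr_ge0// mulr_natl mulr2n lerD2r.
by rewrite powRM// ler_wpM2l ?powR_ge0// lerDr powR_ge0.
Qed.

Section integral.
Local Open Scope ereal_scope.
Context d (T : measurableType d) (R : realType).

(* Unlike in [ge0_le_integral], the integrands need not be measurable. *)
Lemma ge0_le_integral_setT (m : {measure set T -> \bar R}) (f g : T -> \bar R) :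
  (forall x, 0 <= f x) -> (forall x, f x <= g x) ->
  \int[m]_x f x <= \int[m]_x g x.
Proof.
move=> f0 fg; rewrite !ge0_integralTE//; last first.
  by move=> x; rewrite (le_trans (f0 x)).
apply: ereal_sup_le => _ [h /= hf <-]; exists h => // x.
exact: le_trans (hf x) (fg x).
Qed.

End integral.

Section wasserstein.
Local Open Scope ereal_scope.
Context (R : realType) (X : riemannian R).
Implicit Types mu nu : probability (pts X) R.

Lemma wasserstein_ge0 p mu nu : 0 <= wasserstein p mu nu.
Proof. by apply: le_ereal_inf_tmp => _ [g _ <-]; exact: poweR_ge0. Qed.

(** The iterates are tied to [opt_map] on measurable sets only; this and the next lemmas let one
    measure replace the other. *)
Lemma null_dominates_eql mu mu' (nu : set (pts X) -> \bar R) :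
  same_measure mu mu' -> mu `<< nu -> mu' `<< nu.
Proof. by move=> mm mn N /mn mN A mA AN; rewrite -mm// mN. Qed.

Lemma null_dominates_eqr nu mu mu' :
  same_measure mu mu' -> nu `<< mu -> nu `<< mu'.
Proof.
by move=> mm nm N mN; apply: nm => A mA AN; rewrite mm// mN.
Qed.

Lemma same_measure_sym mu nu : same_measure mu nu -> same_measure nu mu.
Proof. by move=> mn A mA; rewrite mn. Qed.

Lemma eq_wasserstein p mu mu' nu :
  same_measure mu mu' -> wasserstein p mu nu = wasserstein p mu' nu.
Proof.
move=> mm; rewrite /wasserstein (_ : coupling mu nu = coupling mu' nu)//.
by apply/seteqP; split=> g gc A mA; have [g1 g2] := gc A mA;
  rewrite g1 g2 mm.
Qed.

Lemma eq_fisher nu mu mu' :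
  same_measure mu mu' -> fisher nu mu = fisher nu mu'.
Proof.
move=> mm; rewrite /fisher.
have -> : `[< nu `<< mu >] = `[< nu `<< mu' >].
  by apply/asbool_equiv_eq; split; apply: null_dominates_eqr => //;
    exact: same_measure_sym.
case: ifP => // _; congr ereal_inf; apply/seteqP; split=> e [h [q [hd mq hq ->]]];
  exists h, q; split=> //; case: hd => mh h0 hd; split=> // A mA;
  rewrite hd//; apply: eq_measure_integral => B mB _;
  by [exact: mm | exact/esym/mm].
Qed.

Lemma fisher_dominates nu mu : fisher nu mu < +oo -> nu `<< mu.
Proof. by rewrite /fisher; case: ifPn => // /asboolP. Qed.

Lemma measurable_gdist (x0 : pts X) : measurable_fun setT (gdist x0).
Proof.
apply: (measurability _ (RGenInftyO.measurableE R)) => // _ [_ [t ->] <-].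
rewrite setTI; apply: sub_sigma_algebra.
rewrite (_ : _ @^-1` _ = [set y : rm_space X | mdist (x0 : rm_space X) y < t]%R).
  rewrite openE => y /= yt; apply/nbhs_ballP.
  exists (t - mdist (x0 : rm_space X) y)%R; first by rewrite /= subr_gt0.
  move=> z; rewrite ballEmdist/= ltrBrDl => /(le_lt_trans _); apply.
  exact: metric_triangle.
by apply/seteqP; split => y /=; rewrite in_itv.
Qed.

(* The distance is not known to be measurable for the product sigma-algebra on
   pairs, so the triangle inequality goes through the measurable minorant h. *)
Lemma Pp_wasserstein_lty (p : R) mu nu : (1 <= p)%R -> mu `<< rm_vol X ->
  Pp p nu -> wasserstein p mu nu < +oo -> Pp p mu.
Proof.
move=> p1 mu_vol [_ [x0 nu_lty]] /ereal_inf_lt[_ [g gc <-]].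
have p0 : (0 < p)%R by exact: lt_le_trans p1.
have pV0 : (p^-1 != 0)%R by rewrite invr_eq0 gt_eqF.
move=> /(lty_poweRy pV0) g_lty.
split=> //; exists x0.
pose a x : R := (gdist x0 x `^ p)%R.
have ma : measurable_fun setT a.
  by apply: (measurableT_comp (measurable_powR _)); exact: measurable_gdist.
have a0 x : (0 <= a x)%R by exact: powR_ge0.
(* Solves [a x <= 2^p (d(x,y)^p + a y)] for the distance term; the coordinates enter separately,
   whence measurability. *)
pose h z : R := Num.max 0%R (a z.1 / 2 `^ p - a z.2)%R.
have c0 : (0 < 2 `^ p :> R)%R by exact: powR_gt0.
have hle z : (h z <= gdist z.1 z.2 `^ p)%R.
  rewrite /h ge_max powR_ge0/= lerBlDr ler_pdivrMr// mulrC.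
  apply: le_trans (powRD_le _ _ _); rewrite ?mdist_ge0 ?(ltW p0)//.
  rewrite ge0_ler_powR ?nnegrE ?addr_ge0 ?mdist_ge0 ?(ltW p0)//.
  rewrite addrC [X in (_ <= _ + X)%R](metric_sym (z.1 : rm_space X)).
  exact: metric_triangle.
have mf : measurable_fun setT (fst : pts X * pts X -> pts X) by [].
have ms : measurable_fun setT (snd : pts X * pts X -> pts X) by [].
have -> : \int[mu]_x (a x)%:E = \int[g]_z (a z.1)%:E.
  rewrite -(@ge0_integral_pushforward _ _ _ _ _ fst mf g setT (EFin \o a))//.
  - apply: eq_measure_integral => A mA _; have [gA _] := gc A mA.
    by rewrite setXT in gA; exact: esym gA.
  - exact/measurable_EFinP.
  - by move=> y _; rewrite lee_fin.
have nu_g : \int[nu]_x (a x)%:E = \int[g]_z (a z.2)%:E.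
  rewrite -(@ge0_integral_pushforward _ _ _ _ _ snd ms g setT (EFin \o a))//.
  - apply: eq_measure_integral => A mA _; have [_ gA] := gc A mA.
    by rewrite setTX in gA; exact: esym gA.
  - exact/measurable_EFinP.
  - by move=> y _; rewrite lee_fin.
have ma1 : measurable_fun setT (fun z : pts X * pts X => a z.1).
  exact: measurableT_comp ma mf.
have ma2 : measurable_fun setT (fun z : pts X * pts X => a z.2).
  exact: measurableT_comp ma ms.
have mh : measurable_fun setT h.
  apply: measurable_maxr => //; apply: measurable_funB => //.
  by apply: measurable_funM.
have h0 z : (0 <= h z)%R by rewrite le_max lexx.
(* The definition of [h] gives [a z.1 <= 2^p (h z + a z.2)]; the integral of [h] is at most the
   transport cost, that of [a z.2] is a moment of [nu]. *)
apply: (@le_lt_trans _ _ (\int[g]_z ((2 `^ p)%:E * ((h z)%:E + (a z.2)%:E)))).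
  apply: ge0_le_integral_setT => z; first by rewrite lee_fin.
  rewrite -EFinD -EFinM lee_fin mulrC -ler_pdivrMr// -lerBlDr.
  by rewrite le_max lexx orbT.
rewrite ge0_integralZl_EFin//; last 2 first.
- by move=> z _; rewrite -EFinD lee_fin addr_ge0.
- by apply: emeasurable_funD; exact/measurable_EFinP.
rewrite ge0_integralD//; last 4 first.
- by move=> z _; rewrite lee_fin.
- exact/measurable_EFinP.
- by move=> z _; rewrite lee_fin.
- exact/measurable_EFinP.
rewrite lte_mul_pinfty ?lee_fin ?(ltW c0)// lte_add_pinfty -?nu_g//.
by apply: le_lt_trans g_lty; apply: ge0_le_integral_setT => z; rewrite lee_fin.
Qed.

End wasserstein.

(** * One factor update and the sequential sweep *)

(* No measurability of the density of opt_map is needed: the Fisher information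
   is +oo without absolute continuity, so the finite smoothness bound already
   gives domination by mustar i, also if opt_map were its default value. *)
Lemma opt_map_contraction (R : realType) (M : nat) (X : 'I_M -> riemannian R)
    (p : R) (f : prod_space (fun i => pts (X i)) -> R)
    (mustar nu : forall i, probability (pts (X i)) R) (eps : 'I_M -> \bar R)
    (i : 'I_M) (L : 'I_M -> R) (lambda : R) (nu' : probability (pts (X i)) R) :
  1 <= p -> same_measure (mustar i) (opt_map f i mustar) ->
  fisher_smooth f p eps mustar i L -> transport_information p (mustar i) lambda ->
  (forall j, j != i -> wball p (eps j) (mustar j) (nu j)) ->
  same_measure nu' (opt_map f i nu) ->
  [/\ Pp p nu', (wasserstein p nu' (mustar i) < +oo)%E &
     fine (wasserstein p nu' (mustar i)) <=
     \sum_(j | j != i) L j / lambda * fine (wasserstein p (nu j) (mustar j))].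
Proof.
move=> p1 fixed [L0 smoothL] [Pstar lambda0 transport] nuB nu'E.
have {smoothL} := smoothL nu nuB.
pose w j := fine (wasserstein p (nu j) (mustar j)).
have w0 j : 0 <= w j by rewrite fine_ge0// wasserstein_ge0.
rewrite (eq_bigr (fun j => (L j * w j)%:E)); last first.
  move=> j ji; rewrite EFinM fineK// ge0_fin_numE ?wasserstein_ge0//.
  by apply: lt_le_trans (leey (eps j)); have [] := nuB j ji.
(* The fixed-point identity turns the reference measure into [mustar i], to which the transport
   inequality applies. *)
rewrite sumEFin -EFin_expe (eq_fisher _ (same_measure_sym fixed)).
set s := \sum_(j | _) _ => fisher_le.
have s0 : 0 <= s by apply: sumr_ge0 => j ji; rewrite mulr_ge0// L0.
have dom : opt_map f i nu `<< mustar i.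
  by apply: fisher_dominates; rewrite (le_lt_trans fisher_le)// ltry.
have := le_trans (transport _ dom) fisher_le.
rewrite -(eq_wasserstein _ _ nu'E).
have := wasserstein_ge0 p nu' (mustar i).
case W : (wasserstein p nu' (mustar i)) => [r| |]//; last first.
  by rewrite expe2 mulyy gt0_muley ?lte_fin ?exprn_gt0// leye_eq.
rewrite lee_fin => r0; rewrite -EFin_expe -EFinM lee_fin -exprMn.
rewrite ler_sqr ?nnegrE ?mulr_ge0 ?(ltW lambda0)// => rs.
have W_lty : (wasserstein p nu' (mustar i) < +oo)%E by rewrite W ltry.
split; last 2 first.
- by rewrite ltry.
- under eq_bigr do rewrite mulrAC.
  by rewrite -mulr_suml ler_pdivlMr// mulrC.
(* The finite distance to [mustar i] transfers the moment; absolute continuity follows the chain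
   from [nu'] to [opt_map], [mustar i] and the volume. *)
apply: (Pp_wasserstein_lty p1 _ Pstar W_lty).
apply: (null_dominates_eql (same_measure_sym nu'E)).
by apply: null_dominates_trans dom _; case: Pstar.
Qed.

Theorem theorem5 (R : realType) (M : nat) (M_gt0 : (0 < M)%N)
    (X : 'I_M -> riemannian R) (p : R) (p_ge1 : 1 <= p)
    (f : prod_space (fun i => pts (X i)) -> R) (pi_Pp : gibbs_Pp p f)
    (mustar : forall i, probability (pts (X i)) R)
    (mustar_fixed : forall i, same_measure (mustar i) (opt_map f i mustar))
    (mustar_Pp : forall i, Pp p (mustar i))
    (eps : 'I_M -> \bar R) (eps_gt0 : forall i, (0 < eps i)%E)
    (welldef : forall i (mu : forall j, probability (pts (X j)) R),
       (forall j, j != i -> wball p (eps j) (mustar j) (mu j)) ->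
       opt_welldef f i mu)
    (L : 'M[R]_M)
    (smooth_i : forall i, fisher_smooth f p eps mustar i (L i))
    (lambda : 'I_M -> R)
    (transport_ii : forall i, transport_information p (mustar i) (lambda i)) :
  let Rm : 'M[R]_M := \matrix_(i, j) if i == j then 0 else L i j / lambda i in
  let A : 'M[R]_M := invmx (1%:M - low_part Rm) *m up_part Rm in
  spectral_radius Rm < 1 ->
  forall delta : 'cV[R]_M, (forall i, 0 < delta i 0) ->
  mxlt (Rm *m delta) delta ->
  forall c : R, 0 < c -> (forall i, ((c * delta i 0)%:E <= eps i)%E) ->
  forall (mu : nat -> forall i, probability (pts (X i)) R) (k : nat),
  (forall i, wball p (c * delta i 0)%:E (mustar i) (mu k i)) ->
  (forall n, (k <= n)%N -> forall i, same_measure (mu n.+1 i)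
     (opt_map f i (fun j => if (j < i)%N then mu n.+1 j else mu n j))) ->
  [/\ mxle (wasserstein_vec p (mu k.+1) mustar)
        (A *m wasserstein_vec p (mu k) mustar),
      forall i, wball p (c * delta i 0)%:E (mustar i) (mu k.+1 i) &
      converges_exponentially p mu mustar k A].
Proof.
move=> Rm A _ delta delta0 Rdelta c c0 c_eps mu k mu_k mu_step.
pose W n := wasserstein_vec p (mu n) mustar.
have Rm0 : mxle 0 Rm.
  move=> i j; rewrite !mxE; case: eqVneq => // ij.
  have [_ l0 _] := transport_ii i; have [L0 _] := smooth_i i.
  by rewrite divr_ge0 ?(ltW l0)// L0// eq_sym.
have RmD : low_part Rm + up_part Rm = Rm.
  by apply: low_upD => i; rewrite mxE eqxx.
have resolventA : (1%:M - low_part Rm) *m A = up_part Rm.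
  by rewrite mulmxA mulmxV ?mul1mx// unitmx_sub1_low_part.
have wball_eps i nu : wball p (c * delta i 0)%:E (mustar i) nu ->
    wball p (eps i) (mustar i) nu.
  by case=> ? lt; split => //; exact: lt_le_trans lt (c_eps i).
have wball_lt i nu : wball p (c * delta i 0)%:E (mustar i) nu ->
    fine (wasserstein p nu (mustar i)) < c * delta i 0.
  move=> [_ lt]; rewrite -lte_fin fineK// ge0_fin_numE ?wasserstein_ge0//.
  exact: lt_trans lt (ltry _).
have step n : (k <= n)%N ->
    (forall i, wball p (c * delta i 0)%:E (mustar i) (mu n i)) ->
    (forall i, wball p (c * delta i 0)%:E (mustar i) (mu n.+1 i)) /\
    mxle (W n.+1) (A *m W n).
  move=> kn mu_n.
  (* Both claims come from one strong induction on [i]: smoothness for factor [i] needs the updated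
     factors [j < i] in their balls. *)
  have sweep i : wball p (c * delta i 0)%:E (mustar i) (mu n.+1 i) /\
      W n.+1 i 0 <= (low_part Rm *m W n.+1 + up_part Rm *m W n) i 0.
    have [m im] := ubnP (val i); elim: m i im => // m IH i im.
    pose nu (j : 'I_M) := if (j < i)%N then mu n.+1 j else mu n j.
    have nuB j : j != i -> wball p (c * delta j 0)%:E (mustar j) (nu j).
      rewrite /nu; case: ifP => // ji _.
      by have [] := IH j (leq_trans ji im).
    have [PW W_lty W_le] := opt_map_contraction p_ge1 (mustar_fixed i)
      (smooth_i i) (transport_ii i) (fun j ji => @wball_eps j _ (nuB j ji))
      (mu_step n kn i).
    have RmE j : j != i -> L i j / lambda i = Rm i j.
      by move=> ji; rewrite mxE eq_sym (negbTE ji).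
    rewrite (eq_bigr (fun j => Rm i j * fine (wasserstein p (nu j) (mustar j))))
      in W_le; last by move=> j ji; rewrite RmE.
    split.
      split => //; rewrite -[ltLHS]fineK ?ge0_fin_numE ?wasserstein_ge0//.
      rewrite lte_fin (le_lt_trans W_le)//.
      (* Strictness comes from [Rdelta]: the sum over [j != i] is empty when [M = 1]. *)
      apply: (@le_lt_trans _ _ (c * (Rm *m delta) i 0)); last by rewrite ltr_pM2l.
      rewrite mxE mulr_sumr [leRHS](bigD1 i)//= mxE eqxx mul0r mulr0 add0r.
      apply: ler_sum => j ji; rewrite mulrCA ler_wpM2l ?mxle0_ge0//.
      exact/ltW/wball_lt/nuB.
    rewrite mxE (le_trans W_le)// !mxE -big_split/=.
    rewrite [leRHS](bigD1 i)//= !mxE ltnn !mul0r !add0r.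
    apply: ler_sum => j ji; rewrite !mxE /nu.
    case: ltngtP => [ij|ij|/val_inj ij]; rewrite ?mul0r ?addr0 ?add0r//.
    by rewrite ij eqxx in ji.
  split=> [i|]; first by have [] := sweep i.
  (* [1 - R_L] sends this difference to [R_L W_{n+1} + R_U W_n - W_{n+1}], nonnegative by
     [sweep]. *)
  have : mxle 0 (A *m W n - W n.+1).
    apply: (low_part_resolvent_ge0 Rm0) => i j; rewrite ord1.
    rewrite mulmxBr mulmxA resolventA mulmxBl mul1mx opprB addrCA addrA.
    have [_] := sweep i; rewrite -subr_ge0.
    by congr (_ <= _); rewrite !mxE; ring.
  by move=> H i j; have := H i j; rewrite !mxE subr_ge0.
have iter m : forall i, wball p (c * delta i 0)%:E (mustar i) (mu (k + m)%N i).
  elim: m => [|m IH]; first by rewrite addn0.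
  by rewrite addnS; have [] := step (k + m)%N (leq_addr _ _) IH.
have A0 : mxle 0 A.
  (* [1 - R_L] maps column [j] of [A] to column [j] of [R_U], which is nonnegative. *)
  have colA j : mxle 0 (col j A).
    apply: (low_part_resolvent_ge0 Rm0) => i i'.
    rewrite colE mulmxA resolventA -colE 3!mxE; case: ifP => // _.
    exact: mxle0_ge0 Rm0.
  by move=> i j; have := colA j i 0; rewrite !mxE.
have W_pow m : mxle (W (k + m)%N) (A ^+ m *m W k).
  elim: m => [|m IH] i j; first by rewrite addn0 expr0 mul1mx.
  rewrite addnS exprS -mulmxA; have [_ le] := step _ (leq_addr _ _) (iter m).
  apply: le_trans (le i j) _; rewrite !mxE; apply: ler_sum => l _.
  by rewrite ler_wpM2l// mxle0_ge0.
have W0 n i j : 0 <= W n i j by rewrite mxE fine_ge0// wasserstein_ge0.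
have [mu_k1 W_k1] := step k (leqnn _) mu_k.
split=> //; split.
- by move=> m i; have [_ lt] := iter m i; exact: lt_trans lt (ltry _).
- exact: W_pow.
- apply: limn_esup_root_le => [|m|r Ar].
  + exact: spectral_radius_ge0.
  + exact: normr_ge0.
  have r0 : 0 < r by exact: le_lt_trans (spectral_radius_ge0 A) Ar.
  have [K K0 HK] := mx_exp_bound Ar r0.
  (* The norm is the largest entry, and entry [i] is at most the sum over [l] of
     [(A ^+ m) i l * W k l 0]. *)
  exists (K * \sum_j W k j 0) => [|m].
    by rewrite mulr_ge0// sumr_ge0.
  rewrite /Num.norm/= mx_normrE; apply/bigmax_leP; split=> [|[i j] _ /=].
    by rewrite !mulr_ge0 ?sumr_ge0 ?exprn_ge0// ltW.
  rewrite ger0_norm; last exact: W0.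
  apply: le_trans (W_pow m i j) _; rewrite mxE mulrAC mulr_sumr ord1.
  apply: ler_sum => l _; rewrite ler_wpM2r//.
  by apply: le_trans (ler_norm _) (HK m i l).
- apply: (spectral_radius_lt1 A0 delta0) => i j; rewrite ord1.
  have : mxlt 0 (delta - A *m delta).
    apply: (low_part_resolvent_gt0 Rm0) => i' j'; rewrite ord1.
    rewrite mulmxBr mulmxA resolventA mulmxBl mul1mx -addrA -opprD -mulmxDl RmD.
    by have := Rdelta i' 0; rewrite !mxE subr_gt0.
  by move=> /(_ i 0); rewrite !mxE subr_gt0.
Qed.
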